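(* Let $A,B\in\mathcal{PM}(n)$ be poset matrices associated with the naturally labelled posets $P_A$ and $P_B$ on $X_n$, respectively. Then $A\sim B$ if and only if $P_A\cong P_B$. Moreover, the cardinality $|\mathcal{PM}(n)/{\sim}|$ is equal to the number of non-isomorphic posets with $n$ elements (i.e. the number of isomorphism classes of $n$-element posets).
   Context: Let $X_n=\{0,1,\ldots,n-1\}$. A naturally labelled (NL) poset on $X_n$ is a partial order $\preceq$ on $X_n$ such that $x\preceq y$ implies $x\le y$. Its poset matrix is the $n\times n$ $(0,1)$-matrix $A=[a_{ij}]_{0\le i,j\le n-1}$ with $a_{ij}=1$ if $j\preceq i$ and $a_{ij}=0$ otherwise. $\mathcal{PM}(n)$ denotes the set of poset matrices of NL posets on $X_n$; equivalently, the $n\times n$ $(0,1)$-matrices that are lower triangular with unit diagonal and transitive ($a_{ij}=1$ and $a_{jk}=1$ imply $a_{ik}=1$). For $A\in\mathcal{PM}(n)$, $P_A$ is the unique NL poset on $X_n$ with poset matrix $A$. Two matrices $A,B\in\mathcal{PM}(n)$ are permutation similar, written $A\sim B$, if there is an $n\times n$ permutation matrix $Q$ with $B=Q^TAQ$; this is an equivalence relation, and $\mathcal{PM}(n)/{\sim}$ is the set of its classes. $P\cong Q$ means the posets are isomorphic. *)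

(* Defs.v *)
From HB Require Import structures.
From mathcomp Require Import all_boot all_order all_fingroup all_algebra.

Set Implicit Arguments.
Unset Strict Implicit.
Unset Printing Implicit Defensive.

Import Order.TTheory GRing.Theory Num.Theory.

Local Open Scope ring_scope.

(* The (non strict) order of a naturally labelled poset on X_n = 'I_n. *)
Record NLposet (n : nat) := NLPoset {
  nl_le :> rel 'I_n;
  nl_refl : reflexive nl_le;
  nl_anti : antisymmetric nl_le;
  nl_trans : transitive nl_le;
  nl_natural : forall x y, nl_le x y -> (x <= y)%N
}.

(* The carrier is an alias of 'I_n, so that its order does not clash with the
   canonical (total) order of 'I_n. *)
Definition nl_carrier (n : nat) (P : NLposet n) : Type := 'I_n.

Fact nl_display : Order.disp_t. Proof. exact: Order.Disp tt tt. Qed.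

HB.instance Definition _ n (P : NLposet n) := Finite.copy (nl_carrier P) 'I_n.
HB.instance Definition _ n (P : NLposet n) :=
  Order.Le_isPOrder.Build nl_display (nl_carrier P)
    (@nl_refl n P) (@nl_anti n P) (@nl_trans n P).

Definition NLfinposet (n : nat) (P : NLposet n) : finPOrderType nl_display :=
  nl_carrier P.

Lemma NLfinposet_leE (n : nat) (P : NLposet n) (x y : NLfinposet P) :
  (x <= y)%O = P x y.
Proof. by []. Qed.

(* Entry (i, j) is 1 iff j precedes i: indices are swapped. *)
Definition poset_matrix (n : nat) (P : NLposet n) : 'M[int]_n :=
  \matrix_(i, j) (P j i)%:R.

Definition PM (n : nat) (A : 'M[int]_n) : Prop :=
  exists P : NLposet n, poset_matrix P = A.
Arguments PM n A : clear implicits.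

Definition matrix_le (n : nat) (A : 'M[int]_n) : rel 'I_n :=
  fun x y => A y x == 1.

Lemma poset_matrixK (n : nat) (P : NLposet n) :
  matrix_le (poset_matrix P) =2 P.
Proof. by move=> x y; rewrite /matrix_le mxE; case: (P x y). Qed.

Lemma matrix_le_refl (n : nat) (A : 'M[int]_n) :
  PM n A -> reflexive (matrix_le A).
Proof. by case=> P <- x; rewrite poset_matrixK nl_refl. Qed.

Lemma matrix_le_anti (n : nat) (A : 'M[int]_n) :
  PM n A -> antisymmetric (matrix_le A).
Proof. by case=> P <- x y; rewrite !poset_matrixK => /nl_anti. Qed.

Lemma matrix_le_trans (n : nat) (A : 'M[int]_n) :
  PM n A -> transitive (matrix_le A).
Proof. by case=> P <- y x z; rewrite !poset_matrixK; apply: nl_trans. Qed.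

Lemma matrix_le_natural (n : nat) (A : 'M[int]_n) :
  PM n A -> forall x y, matrix_le A x y -> (x <= y)%N.
Proof. by case=> P <- x y; rewrite poset_matrixK; apply: nl_natural. Qed.

Definition poset_of_matrix (n : nat) (A : 'M[int]_n) (hA : PM n A) :
    NLposet n :=
  NLPoset (matrix_le_refl hA) (matrix_le_anti hA)
          (matrix_le_trans hA) (matrix_le_natural hA).

Lemma poset_of_matrixK (n : nat) (A : 'M[int]_n) (hA : PM n A) :
  poset_matrix (poset_of_matrix hA) = A.
Proof.
apply/matrixP => i j; rewrite mxE /=; case: hA => P <-.
by rewrite poset_matrixK mxE.
Qed.

Lemma poset_of_matrix_uniq (n : nat) (A : 'M[int]_n) (hA : PM n A)
    (P : NLposet n) :
  poset_matrix P = A -> P =2 poset_of_matrix hA.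
Proof. by move=> PA x y; rewrite /= -PA poset_matrixK. Qed.

Lemma PM_charP (n : nat) (A : 'M[int]_n) :
  PM n A <->
  [/\ forall i j, A i j = 0 \/ A i j = 1,
      is_trig_mx A,
      forall i, A i i = 1
    & forall i j k, A i j = 1 -> A j k = 1 -> A i k = 1].
Proof.
split=> [[P <-]|[A01 /is_trig_mxP Atr A1 At]].
  split=> [i j||i|i j k].
  - by rewrite mxE; case: (P j i); [right|left].
  - apply/is_trig_mxP => i j ij; rewrite mxE.
    by case: (boolP (P j i)) => // /nl_natural; rewrite leqNgt ij.
  - by rewrite mxE nl_refl.
  - rewrite !mxE; case Pji: (P j i) => // _; case Pkj: (P k j) => // _.
    by rewrite (nl_trans Pkj Pji).
pose r (x y : 'I_n) := A y x == 1.
have rnat x y : r x y -> (x <= y)%N.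
  by rewrite leqNgt /r => /eqP Ayx; apply/negP => /Atr; rewrite Ayx.
have rr : reflexive r by move=> x; rewrite /r A1.
have ra : antisymmetric r.
  move=> x y /andP[/rnat xy /rnat yx].
  by apply/val_inj/eqP; rewrite eqn_leq xy yx.
have rt : transitive r.
  by move=> y x z /eqP yx /eqP zy; apply/eqP/(At _ _ _ zy yx).
exists (NLPoset rr ra rt rnat); apply/matrixP => i j; rewrite mxE /= /r.
by case: (A01 i j) => ->.
Qed.

Definition perm_similar (n : nat) (A B : 'M[int]_n) : Prop :=
  exists2 Q : 'M[int]_n, is_perm_mx Q & B = Q^T *m A *m Q.

Definition poset_iso (d d' : Order.disp_t)
    (P : finPOrderType d) (Q : finPOrderType d') : Prop :=
  exists2 f : P -> Q, bijective f & {mono f : x y / (x <= y)%O}.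

(* X/R as the type of the classes of R on X, a class being a subset of X given
   by its membership predicate. Classes are not [set]s of MathComp-Analysis,
   whose universe is too small to contain finPOrderType. *)
Definition quotient_by (T : Type) (X : T -> Prop) (R : T -> T -> Prop) : Type :=
  {C : T -> Prop | exists2 x, X x & C = (fun y => X y /\ R x y)}.

Definition has_cardinality (T : Type) (N : nat) : Prop :=
  exists f : T -> 'I_N, bijective f.

Lemma perm_similar_refl n (A : 'M[int]_n) : perm_similar A A.
Proof.
by exists 1%:M; rewrite ?is_perm_mx1 // trmx1 mul1mx mulmx1.
Qed.

Lemma perm_similar_sym n (A B : 'M[int]_n) :
  perm_similar A B -> perm_similar B A.
Proof.
case=> _ /is_perm_mxP[s ->] ->; exists (perm_mx s)^T.
  by rewrite is_perm_mx_tr perm_mx_is_perm.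
rewrite trmxK tr_perm_mx !mulmxA -perm_mxM mulgV perm_mx1 mul1mx.
by rewrite -mulmxA -perm_mxM mulgV perm_mx1 mulmx1.
Qed.

Lemma perm_similar_trans n (B A C : 'M[int]_n) :
  perm_similar A B -> perm_similar B C -> perm_similar A C.
Proof.
case=> Q hQ -> [S hS ->]; exists (Q *m S); first by rewrite is_perm_mxMl.
by rewrite trmx_mul !mulmxA.
Qed.

Lemma poset_iso_refl d (P : finPOrderType d) : poset_iso P P.
Proof. by exists id => //; exists id. Qed.

Lemma poset_iso_sym d d' (P : finPOrderType d) (Q : finPOrderType d') :
  poset_iso P Q -> poset_iso Q P.
Proof.
case=> f [g fK gK] fmono; exists g; first by exists f.
by move=> x y; rewrite -fmono !gK.
Qed.

Lemma poset_iso_trans d d' d'' (P : finPOrderType d) (Q : finPOrderType d')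
    (S : finPOrderType d'') :
  poset_iso P Q -> poset_iso Q S -> poset_iso P S.
Proof.
case=> f fb fm [g gb gm]; exists (g \o f); first exact: bij_comp.
by move=> x y; rewrite /= gm fm.
Qed.

(* Main.v *)
(** Counting strict predecessors and sorting by that count gives a linear
    extension of any finite poset, so every [n]-element poset is isomorphic to a
    naturally labelled one.  Hence both quotients are the quotient of one finite
    family of natural labellings by one equivalence relation. *)
Require Import Defs.
From HB Require Import structures.
From mathcomp Require Import all_boot all_order all_fingroup all_algebra.
From mathcomp Require Import boolp.

Set Implicit Arguments.
Unset Strict Implicit.
Unset Printing Implicit Defensive.

Import Order.TTheory GRing.Theory.

Local Open Scope ring_scope.

(** Conjugation by [perm_mx s] only reindexes entries, by [s^-1] on rows and columns alike; moving
    [s] to the side of [B] removes the inverse. *)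
Lemma perm_similarP n (A B : 'M[int]_n) :
  perm_similar A B <-> exists s : 'S_n, forall i j, B (s i) (s j) = A i j.
Proof.
have conjE (s : 'S_n) :
    (perm_mx s)^T *m A *m perm_mx s = \matrix_(i, j) A (s^-1%g i) (s^-1%g j).
  rewrite tr_perm_mx -row_permE -{2}[s]invgK -col_permE.
  by apply/matrixP => i j; rewrite !mxE.
split=> [[_ /is_perm_mxP[s ->] ->]|[s sB]].
  by exists s => i j; rewrite conjE mxE !permK.
exists (perm_mx s); first exact: perm_mx_is_perm.
by rewrite conjE; apply/matrixP => i j; rewrite mxE -sB !permKV.
Qed.

Lemma perm_similar_poset_iso n (P Q : NLposet n) :
  perm_similar (poset_matrix P) (poset_matrix Q) <->
  poset_iso (NLfinposet P) (NLfinposet Q).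
Proof.
rewrite perm_similarP; split=> [[s sPQ]|[f fbij fmono]].
  exists (s : 'I_n -> 'I_n).
    by exists s^-1%g; [exact: permK|exact: permKV].
  move=> x y; rewrite !NLfinposet_leE -!poset_matrixK /matrix_le.
  by rewrite [X in X == 1]sPQ.
exists (perm (bij_inj fbij : injective (f : 'I_n -> 'I_n))) => i j.
by rewrite !permE !mxE -!NLfinposet_leE fmono.
Qed.

(* The same order under another display: the second quotient only contains
   posets of display [d], whereas [NLfinposet] has display [nl_display]. *)
Definition redisplay (d d' : Order.disp_t) (P : finPOrderType d') : Type := P.

HB.instance Definition _ d d' (P : finPOrderType d') :=
  Finite.copy (redisplay d P) P.
HB.instance Definition _ d d' (P : finPOrderType d') :=
  Order.Le_isPOrder.Build d (redisplay d P)
    (@le_refl d' P) (@le_anti d' P) (@le_trans d' P).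

Lemma redisplay_iso d d' (P : finPOrderType d') :
  poset_iso P (redisplay d P : finPOrderType d).
Proof. by exists id => //; exists id. Qed.

Lemma linear_extension d (P : finPOrderType d) :
  exists2 f : P -> 'I_#|P|, bijective f &
    forall x y, (x <= y)%O -> (f x <= f y)%N.
Proof.
pose h (x : P) := #|[set y | (y < x)%O]|.
have h_lt x y : (x < y)%O -> (h x < h y)%N.
  move=> xy; apply/proper_card/properP; split.
    by apply/subsetP => z; rewrite !inE => /lt_trans; apply.
  by exists x; rewrite inE ?ltxx.
(* Ties in [h] may fall in any order: by [h_lt] they are equal or incomparable elements. *)
pose r := relpre h leq; pose s := sort r (enum P).
have mem_s x : x \in s by rewrite mem_sort mem_enum.
have size_s : size s = #|P| by rewrite size_sort -cardE.
have lt_s x : (index x s < #|P|)%N by rewrite -size_s index_mem.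
have f_inj : injective (fun x => Ordinal (lt_s x)).
  by move=> x y [] /index_inj; apply.
exists (fun x => Ordinal (lt_s x)).
  by apply: inj_card_bij f_inj _; rewrite card_ord.
move=> x y; rewrite le_eqVlt => /predU1P[-> //|/h_lt hxy] /=.
rewrite leqNgt; apply: contraL hxy => yx; rewrite -leqNgt.
(* If [y] stood before [x] in [s], sortedness would give [h y <= h x], against [hxy]. *)
apply: (@sorted_ltn_index _ r _ s _ y x) yx => //.
- by move=> ? ? ?; apply: leq_trans.
- by apply: sort_sorted => ? ?; apply: leq_total.
Qed.

(** The order is transported along a linear extension, whose monotonicity is exactly naturality of
    the labelling. *)
Lemma natural_labelling d (P : finPOrderType d) :
  exists Q : NLposet #|P|, poset_iso P (NLfinposet Q).
Proof.
have [f [g fK gK] fle] := linear_extension P.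
pose r i j := (g i <= g j)%O.
have r_refl : reflexive r by move=> i; apply: lexx.
have r_anti : antisymmetric r by move=> i j /le_anti /(can_inj gK).
have r_trans : transitive r by move=> j i k; apply: le_trans.
have r_nat i j : r i j -> (i <= j)%N by move/fle; rewrite !gK.
exists (NLPoset r_refl r_anti r_trans r_nat); exists f; first by exists g.
by move=> x y; rewrite NLfinposet_leE /= /r !fK.
Qed.

(** An [NLposet] carries proofs, so the finite index type consists of the Boolean graphs of such
    orders, with one labelling chosen per graph; this recovers [P] up to [=2]. *)
Lemma NLposet_finite n :
  exists (F : finType) (p : F -> NLposet n),
    forall P : NLposet n, exists a, p a =2 P.
Proof.
pose graph_of (r : {ffun 'I_n * 'I_n -> bool}) (P : NLposet n) :=
  forall x y, P x y = r (x, y).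
pose is_graph r := `[< exists P, graph_of r P >]; pose F := {r | is_graph r}.
have graphP (a : F) : exists P, graph_of (val a) P by apply/asboolP/(valP a).
have [p pP] := choice graphP.
exists F, p => P.
have rP : is_graph [ffun z => P z.1 z.2].
  by apply/asboolP; exists P => x y; rewrite ffunE.
by exists (exist (fun r => is_graph r) _ rP) => x y; rewrite pP ffunE.
Qed.

Lemma poset_matrix_eq n (P Q : NLposet n) :
  P =2 Q -> poset_matrix P = poset_matrix Q.
Proof. by move=> PQ; apply/matrixP => i j; rewrite !mxE PQ. Qed.

Section QuotientCardinality.
Variables (T : Type) (X : T -> Prop) (R : T -> T -> Prop).
Hypotheses (R_refl : forall x, R x x) (R_sym : forall x y, R x y -> R y x).
Hypothesis R_trans : forall x y z, R x y -> R y z -> R x z.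
Variables (F : finType) (e : rel F) (g : F -> T).
Hypotheses (gX : forall a, X (g a)) (eP : forall a b, e a b <-> R (g a) (g b)).
Hypothesis g_onto : forall x, X x -> exists a, R x (g a).

(** Each [R]-class meets the image of [g], and pulling it back along [g] gives one [e]-class. The
    count depends on [F] and [e] alone, so two quotients sharing them have the same cardinality. *)
Lemma quotient_by_card :
  has_cardinality (quotient_by X R) #|[set [set b | e a b] | a in F]|.
Proof.
set E := [set _ | a in F].
have class_rep (C : quotient_by X R) :
    exists a, sval C = (fun y => X y /\ R (g a) y).
  have [x Xx ->] := svalP C; have [a xa] := g_onto Xx; exists a.
  apply: funext => y; apply: propext; split=> -[Xy]; split=> //.
    exact: R_trans (R_sym xa) _.
  exact: R_trans xa _.
have [rep repP] := choice class_rep.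
have classE C : [set b | e (rep C) b] \in E by exact: imset_f.
pose f C := enum_rank_in (classE C) [set b | e (rep C) b].
have f_inj : injective f.
  move=> C D /(congr1 enum_val); rewrite !enum_rankK_in // => /setP eCD.
  (* [rep D] lies in its own [e]-class, which is also that of [rep C]. *)
  have {eCD} /eP CD : e (rep C) (rep D).
    by have := eCD (rep D); rewrite !inE => ->; apply/eP.
  apply: eq_sig_hprop => [?|]; first exact: Prop_irrelevance.
  rewrite (repP C) (repP D); apply: funext => y.
  apply: propext; split=> -[Xy]; split=> //.
    exact: R_trans (R_sym CD) _.
  exact: R_trans CD _.
have f_onto i : exists C, f C = i.
  have /imsetP[a _ ia] := enum_valP i.
  have aX :
      exists2 x, X x & (fun y => X y /\ R (g a) y) = (fun y => X y /\ R x y).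
    by exists (g a).
  pose C : quotient_by X R := exist _ _ aX; exists C.
  (* The chosen [rep C] may differ from [a], but [g a] belongs to [C], which [repP] describes
     through [rep C]. *)
  have [_ Ca] : X (g a) /\ R (g (rep C)) (g a).
    have /= := congr1 (fun c => c (g a)) (repP C) => <-.
    by split.
  apply: enum_val_inj; rewrite enum_rankK_in // ia; apply/setP => b.
  rewrite !inE; apply/idP/idP => /eP ab; apply/eP.
    exact: R_trans (R_sym Ca) _.
  exact: R_trans Ca _.
have [h fh] := choice f_onto.
by exists f; exists h => // C; apply: f_inj; rewrite fh.
Qed.

End QuotientCardinality.

Theorem theorem2p4 (d : Order.disp_t) (n : nat) :
  (forall (A B : 'M[int]_n) (hA : PM n A) (hB : PM n B),
     perm_similar A B <->
     poset_iso (NLfinposet (poset_of_matrix hA))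
               (NLfinposet (poset_of_matrix hB))) /\
  (exists N : nat,
     has_cardinality (quotient_by (PM n) (@perm_similar n)) N /\
     has_cardinality
       (quotient_by (fun P : finPOrderType d => #|P| = n)
                    (@poset_iso d d)) N).
Proof.
split=> [A B hA hB|].
  by rewrite -perm_similar_poset_iso !poset_of_matrixK.
have [F [p p_onto]] := NLposet_finite n.
pose e a b := `[< perm_similar (poset_matrix (p a)) (poset_matrix (p b)) >].
(* The common number counts the similarity classes of the chosen labellings. *)
exists #|[set [set b | e a b] | a in F]|; split.
  apply: (@quotient_by_card _ _ _ _ _ _ F e (fun a => poset_matrix (p a))).
  - exact: perm_similar_refl.
  - exact: perm_similar_sym.
  - by move=> A B C; apply: perm_similar_trans.
  - by move=> a; exists (p a).
  - by move=> a b; split=> [/asboolP|/asboolP].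
  - move=> _ [P <-]; have [a /poset_matrix_eq <-] := p_onto P.
    by exists a; apply: perm_similar_refl.
apply: (@quotient_by_card _ _ _ _ _ _ F e
  (fun a => redisplay d (NLfinposet (p a)) : finPOrderType d)).
- exact: poset_iso_refl.
- by move=> P Q; apply: poset_iso_sym.
- by move=> P Q S; apply: poset_iso_trans.
- by move=> a; apply: card_ord.
- move=> a b; have isoP c := redisplay_iso d (NLfinposet (p c)).
  split=> [/asboolP/perm_similar_poset_iso ab|ab].
    exact: poset_iso_trans (poset_iso_sym (isoP a))
                          (poset_iso_trans ab (isoP b)).
  apply/asboolP/perm_similar_poset_iso.
  exact: poset_iso_trans (isoP a) (poset_iso_trans ab (poset_iso_sym (isoP b))).
(* Replacing [n] by [#|P|] everywhere, including in the types of [F]'s labellings, lets [p_onto]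
   apply to a natural labelling of [P]. *)
- move=> P Pn; case: n / Pn F p p_onto @e => F p p_onto _.
  have [Q PQ] := natural_labelling P.
  have [a /poset_matrix_eq paQ] := p_onto Q; exists a.
  apply: poset_iso_trans PQ (poset_iso_trans _ (redisplay_iso d _)).
  by apply/perm_similar_poset_iso; rewrite paQ; apply: perm_similar_refl.
Qed.
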